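(* Let $D_1,D_2,D_3\subseteq\mathbb{R}^2$ be closed discs, $D_i=\{(x,y):(x-x_i)^2+(y-y_i)^2\le r_i^2\}$ with $r_i\ge 0$, and let $C_i=\{(x,y):(x-x_i)^2+(y-y_i)^2=r_i^2\}$ be the bounding circle of $D_i$. Then $D_1\cap D_2\cap D_3\neq\emptyset$ if and only if one of the following holds: (1) for some $i\in\{1,2,3\}$ the center $(x_i,y_i)$ of $D_i$ lies in both other discs; or (2) (1) does not hold and there exist distinct $i,j\in\{1,2,3\}$ and a point $p\in C_i\cap C_j$ with $p\in D_k$, where $k$ is the remaining index. *)

(* Defs.v *)
From HB Require Import structures.
From mathcomp Require Import all_boot all_order all_algebra.
From mathcomp Require Import boolp classical_sets reals.

Set Implicit Arguments.
Unset Strict Implicit.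
Unset Printing Implicit Defensive.

Import Order.TTheory GRing.Theory Num.Theory.

Local Open Scope classical_set_scope.
Local Open Scope ring_scope.

(* The plane is R * R with Euclidean distances written out by coordinates,
   because the library norm on R * R is the sup norm. *)
Definition disc (R : realType) (c : R * R) (r : R) : set (R * R) :=
  [set p | (p.1 - c.1) ^+ 2 + (p.2 - c.2) ^+ 2 <= r ^+ 2].

Definition circle (R : realType) (c : R * R) (r : R) : set (R * R) :=
  [set p | (p.1 - c.1) ^+ 2 + (p.2 - c.2) ^+ 2 = r ^+ 2].

Definition center_in_other_discs (R : realType)
    (c : 'I_3 -> R * R) (r : 'I_3 -> R) : Prop :=
  exists i : 'I_3, forall j : 'I_3, j != i -> disc (c j) (r j) (c i).

(* The pairwise distinctness of i, j, k in 'I_3 makes k the remaining index. *)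
Definition circles_meet_in_third_disc (R : realType)
    (c : 'I_3 -> R * R) (r : 'I_3 -> R) : Prop :=
  exists i j k : 'I_3, [/\ i != j, k != i, k != j &
    exists p : R * R,
      (circle (c i) (r i) `&` circle (c j) (r j)) p /\ disc (c k) (r k) p].

(* Main.v *)
Require Import Defs.
From HB Require Import structures.
From mathcomp Require Import all_boot all_order all_algebra.
From mathcomp Require Import ring lra.
From mathcomp Require Import boolp classical_sets reals.
From mathcomp Require Import topology normedtype realfun trigo.

Set Implicit Arguments.
Unset Strict Implicit.
Unset Printing Implicit Defensive.

Import Order.TTheory GRing.Theory Num.Theory.
Import numFieldNormedType.Exports.

Local Open Scope classical_set_scope.
Local Open Scope ring_scope.

(* If the discs have a common point, walking from it along a ray until it
   first meets a bounding circle gives a common point p on some circle C_j.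
   Walk along C_j from p to its antipode: either another circle is met while
   still inside the third disc, or the antipode also lies in the two other
   discs, and then so does the midpoint of p and its antipode, namely the
   center of D_j. *)

(** The intermediate value theorem applies to [max f g], which is nonpositive at [a] and positive at
    [b]; where it vanishes, one function is zero and the other at most zero. *)
Lemma continuous_exit (R : realType) (f g : R -> R) (a b : R) :
  continuous f -> continuous g -> a <= b -> f a <= 0 -> g a <= 0 ->
  0 < f b \/ 0 < g b ->
  exists t, (f t = 0 /\ g t <= 0) \/ (g t = 0 /\ f t <= 0).
Proof.
move=> fc gc ab fa ga fgb.
have [||t _ ht] := @IVT R (fun t => Num.max (f t) (g t)) a b 0 ab.
- apply: continuous_subspaceT => x.
  by apply: continuous_max; [apply: fc|apply: gc].
- rewrite ge_min le_max !ge_max fa ga /=.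
  by apply/orP; right; rewrite le_max; case: fgb => /ltW ->; rewrite ?orbT.
exists t; move: ht; case: (leP (f t) (g t)) => [fg g0|/ltW gf f0].
- by right; split => //; rewrite -g0.
- by left; split => //; rewrite -f0.
Qed.

(** The power of a point: its sign turns leaving a disc into a sign change, as [continuous_exit]
    requires. *)
Definition power (R : realType) (c : R * R) (r : R) (p : R * R) : R :=
  (p.1 - c.1) ^+ 2 + (p.2 - c.2) ^+ 2 - r ^+ 2.

Lemma discE (R : realType) (c : R * R) (r : R) (p : R * R) :
  disc c r p <-> power c r p <= 0.
Proof. by rewrite /disc /power /= subr_le0. Qed.

Lemma circleE (R : realType) (c : R * R) (r : R) (p : R * R) :
  circle c r p <-> power c r p = 0.
Proof.
by rewrite /circle /power /=; split; [move=> ->; rewrite subrr|move/subr0_eq].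
Qed.

Lemma continuous_power (R : realType) (c : R * R) (r : R) (u v : R -> R) :
  continuous u -> continuous v -> continuous (fun t => power c r (u t, v t)).
Proof.
move=> uc vc t; rewrite /power /=.
apply: cvgB; last exact: cvg_cst.
by apply: cvgD; apply: cvgM; apply: cvgB;
  (exact: cvg_cst || apply: uc || apply: vc).
Qed.

(** The second point is the reflection [p'] of [p] in [m], and [|p - c|^2 + |p' - c|^2 = 2 |m - c|^2
    + 2 |m - p|^2]. *)
Lemma disc_midpoint (R : realType) (c : R * R) (r : R) (m p : R * R) :
  disc c r p -> disc c r (m.1 *+ 2 - p.1, m.2 *+ 2 - p.2) -> disc c r m.
Proof.
rewrite /disc /= => h1 h2.
have := sqr_ge0 (m.1 - p.1); have := sqr_ge0 (m.2 - p.2).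
nra.
Qed.

Lemma circle_exit (R : realType) (c c1 c2 : R * R) (r r1 r2 : R) (p : R * R) :
  circle c r p -> disc c1 r1 p -> disc c2 r2 p ->
  (disc c1 r1 c /\ disc c2 r2 c) \/
  exists q, circle c r q /\
    ((circle c1 r1 q /\ disc c2 r2 q) \/ (circle c2 r2 q /\ disc c1 r1 q)).
Proof.
move=> cp d1p d2p; pose q := (c.1 *+ 2 - p.1, c.2 *+ 2 - p.2).
have [[d1q d2q]|dq] := pselect (disc c1 r1 q /\ disc c2 r2 q).
  by left; split; [apply: disc_midpoint d1p d1q|apply: disc_midpoint d2p d2q].
right.
(* [(x t, y t)] is [p] rotated about [c] by the angle [t]; it runs along the circle from [p] to its
   antipode [q]. *)
pose x (t : R) := c.1 + (p.1 - c.1) * cos t - (p.2 - c.2) * sin t.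
pose y (t : R) := c.2 + (p.2 - c.2) * cos t + (p.1 - c.1) * sin t.
have xc : continuous x.
  move=> t; apply: cvgB; first apply: cvgD; first exact: cvg_cst.
    by apply: cvgM; [exact: cvg_cst|exact: continuous_cos].
  by apply: cvgM; [exact: cvg_cst|exact: continuous_sin].
have yc : continuous y.
  move=> t; apply: cvgD; first apply: cvgD; first exact: cvg_cst.
    by apply: cvgM; [exact: cvg_cst|exact: continuous_cos].
  by apply: cvgM; [exact: cvg_cst|exact: continuous_sin].
have xy0 : (x 0, y 0) = p.
  by rewrite /x /y cos0 sin0; case: (p) => ? ? /=; congr pair; ring.
have xypi : (x pi, y pi) = q.
  by rewrite /x /y /q cospi sinpi; congr pair; ring.
have [||||t ht] := @continuous_exit R _ _ 0 pi
  (continuous_power (c := c1) (r := r1) xc yc)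
  (continuous_power (c := c2) (r := r2) xc yc).
- exact: pi_ge0.
- by rewrite xy0; apply/discE.
- by rewrite xy0; apply/discE.
- rewrite xypi; case: (ltP 0 (power c1 r1 q)) => [|h1]; first by left.
  case: (ltP 0 (power c2 r2 q)) => [|h2]; first by right.
  by case: dq; split; apply/discE.
exists (x t, y t); split.
  rewrite /circle /= -cp /x /y.
  have := cos2Dsin2 t => cs.
  rewrite -[RHS]mulr1 -cs; ring.
by case: ht => -[h1 h2]; [left|right]; split; rewrite ?circleE ?discE.
Qed.

(** The walk follows the horizontal ray from [q] to the right. Merging two of the powers into the
    single function [g] by a maximum lets the two-function [continuous_exit] handle three discs. *)
Lemma discs_meet_on_circle (R : realType) (c c1 c2 : R * R) (r r1 r2 : R)
    (q : R * R) :
  disc c r q -> disc c1 r1 q -> disc c2 r2 q ->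
  exists p, [/\ disc c r p, disc c1 r1 p, disc c2 r2 p &
    [\/ circle c r p, circle c1 r1 p | circle c2 r2 p]].
Proof.
move=> d0 d1 d2.
have idc : continuous (fun t : R => t) by move=> t; exact: cvg_id.
have cc : continuous (fun _ : R => q.2) by move=> t; exact: cvg_cst.
have pc c' r' := continuous_power (c := c') (r := r') idc cc.
pose g t := Num.max (power c1 r1 (t, q.2)) (power c2 r2 (t, q.2)).
have gc : continuous g.
  by move=> t; apply: (continuous_max (pc c1 r1 t) (pc c2 r2 t)).
(* The end abscissa is at least [c.1 + |r| + 1], hence beyond the first disc. *)
have [||||t ht] := @continuous_exit R _ g q.1
  (q.1 + `|c.1 - q.1| + `|r| + 1) (pc c r) gc.
- by rewrite -!addrA lerDl !addr_ge0.
- by rewrite -surjective_pairing; apply/discE.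
- by rewrite /g -surjective_pairing ge_max; apply/andP; split; apply/discE.
- left; rewrite /power /=.
  have h : c.1 - q.1 <= `|c.1 - q.1| := ler_norm _.
  have := sqr_ge0 (q.2 - c.2); rewrite -[r ^+ 2]real_normK ?num_real //.
  have := normr_ge0 r; move: `|r| `|_| h => s u h s0 v0.
  (* With [s = |r|], this is the factored difference of squares bounding the power from below. *)
  have : 0 < (q.1 + u + s + 1 - c.1 - s) * (q.1 + u + s + 1 - c.1 + s).
    by apply: mulr_gt0; lra.
  nra.
exists (t, q.2); case: ht => -[]; rewrite /g.
  move=> f0; rewrite ge_max => /andP[g1 g2].
  by split; [apply/discE; rewrite f0|exact/discE|exact/discE
    |apply: Or31; exact/circleE].
(* Here the maximum [g] vanishes: the larger power gives the circle, the smaller a disc. *)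
case: (leP (power c1 r1 _)) => [h12 g0 f0|/ltW h12 g0 f0]; rewrite g0 in h12.
  by split; [exact/discE|exact/discE|apply/discE; rewrite g0
    |apply: Or33; exact/circleE].
by split; [exact/discE|apply/discE; rewrite g0|exact/discE
  |apply: Or32; exact/circleE].
Qed.

Lemma ord3_third (i j k l : 'I_3) :
  i != j -> k != i -> k != j -> l != i -> l != j -> l = k.
Proof.
move=> ij ki kj li lj; apply/val_inj; move: ij ki kj li lj.
by case: i j k l => [[|[|[|?]]] ?] [[|[|[|?]]] ?] [[|[|[|?]]] ?] [[|[|[|?]]] ?].
Qed.

Lemma ord3_others (j : 'I_3) : exists i k : 'I_3, [/\ i != j, k != i & k != j].
(* Addition in ['I_3] is modulo 3. *)
Proof. by exists (j + 1), (j + 2%:R); case: j => [[|[|[|?]]] ?]. Qed.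

Theorem theorem2 (R : realType) (c : 'I_3 -> R * R) (r : 'I_3 -> R)
    (r_ge0 : forall i : 'I_3, 0 <= r i) :
  \bigcap_(i in [set: 'I_3]) disc (c i) (r i) !=set0 <->
  center_in_other_discs c r \/
  (~ center_in_other_discs c r /\ circles_meet_in_third_disc c r).
Proof.
split; last first.
  case=> [[i hi]|[_ [i [j [k [ij ki kj [p [[ci cj] dk]]]]]]]].
    exists (c i) => j _; have [->|/hi//] := eqVneq j i.
    by rewrite /disc /= !subrr expr0n /= addr0 sqr_ge0.
  exists p => l _; have [->|li] := eqVneq l i; first by rewrite /disc /= ci.
  have [->|lj] := eqVneq l j; first by rewrite /disc /= cj.
  by rewrite (ord3_third ij ki kj li lj).
case=> q hq.
have [ctr|nctr] := pselect (center_in_other_discs c r); first by left.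
right; split=> //.
have [j [p [cp dp]]] : exists j p,
    circle (c j) (r j) p /\ forall i, disc (c i) (r i) p.
  have [i [k [i0 ki k0]]] := ord3_others 0.
  have [p [d0 di dk hp]] := discs_meet_on_circle (hq 0 I) (hq i I) (hq k I).
  have dp l : disc (c l) (r l) p.
    have [->//|li] := eqVneq l i; have [->//|l0] := eqVneq l 0.
    by rewrite (ord3_third i0 ki k0 li l0).
  by case: hp => h; [exists 0, p|exists i, p|exists k, p].
have [i [k [ij ki kj]]] := ord3_others j.
(* The first outcome puts the center of disc [j] in both other discs, against [nctr]. *)
have [[di dk]|[s [cs hs]]] := circle_exit cp (dp i) (dp k).
  case: nctr; exists j => l lj; have [->//|li] := eqVneq l i.
  by rewrite (ord3_third ij ki kj li lj).
case: hs => -[h1 h2].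
- by exists i, j, k; split=> //; exists s.
- by exists k, j, i; split=> //; [rewrite eq_sym|exists s].
Qed.
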